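(* Let $X$ be a complete, locally compact, geodesic metric space and let $x\in X$ be a point satisfying the $\mathrm{LEG}$ condition with parameter $\epsilon>0$ and the $\mathrm{LRB}$ condition with parameters $H>0$ and $K\ge 1$. Then for every $0<r<\frac{\min\{\epsilon,H\}}{12K}$: (1) there is a bi-Lipschitz embedding of $B_r(x)$ into a finite dimensional Euclidean space; (2) $B_r(x)$ satisfies the doubling condition (considered as a metric space with the metric induced from $X$).
   Context: A metric space is geodesic if every two points $x,y$ are joined by a continuous curve of length $d(x,y)$. $B_r(x)$ denotes the open ball, regarded as a metric space with the induced metric. $\mathrm{LEG}$ (locally extendable geodesics) condition: a point $x$ of a complete geodesic metric space $X$ satisfies $\mathrm{LEG}$ with parameter $\epsilon>0$ if for every unit speed minimizing geodesic $\gamma:[0,T]\to B_\epsilon(x)$ there exists a unit speed minimizing geodesic $\widetilde\gamma:[0,T+\epsilon]\to X$ with $\widetilde\gamma(t)=\gamma(t)$ for all $t\in[0,T]$. $\mathrm{LRB}$ (locally rough Busemann) condition: a point $x$ of a complete geodesic metric space $X$ satisfies $\mathrm{LRB}$ with parameters $H,K>0$ if for every pair of unit speed minimizing geodesics $\gamma_1:[0,L_1]\to B_H(x)$, $\gamma_2:[0,L_2]\to B_H(x)$ with $\gamma_1(0)=\gamma_2(0)$ we have $d(\gamma_1(tL_1),\gamma_2(tL_2))\le K\,t\,d(\gamma_1(L_1),\gamma_2(L_2))$ for every $t\in[0,1]$. A metric space satisfies the doubling condition if there is $\lambda\in\mathbb{N}$ such that, for every $\rho>0$, every ball of radius $\rho$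 in it can be covered by at most $\lambda$ balls of radius $\rho/2$. *)

(* Defs.v *)
From HB Require Import structures.
From mathcomp Require Import all_boot all_order all_algebra.
From mathcomp Require Import all_classical all_reals all_analysis.

Set Implicit Arguments.
Unset Strict Implicit.
Unset Printing Implicit Defensive.

Import Order.TTheory GRing.Theory Num.Theory.
Import numFieldNormedType.Exports.

Local Open Scope classical_set_scope.
Local Open Scope ring_scope.

#[short(type="completeMetricType")]
HB.structure Definition CompleteMetric (K : numDomainType) :=
  {T of Metric K T & Complete T}.

(* The metric induced on a subset.  The library already makes [set_type A] a
   pseudometric space whose balls are the traces on [A] of balls of [X]. *)
Section induced_metric.
Context {R : realType} {X : metricType R} (A : set X).

Let dist (u v : set_type A) : R := mdist (set_val u) (set_val v).

Let dist_ge0 u v : 0 <= dist u v.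
Proof. exact: mdist_ge0. Qed.

Let dist_positivity u v : dist u v = 0 -> u = v.
Proof. by move=> /mdist_positivity; exact: val_inj. Qed.

Let ballE (u : set_type A) (e : R) : ball u e = [set v | dist u v < e].
Proof.
rewrite -(@initial_ballE _ _ _ (set_val : set_type A -> X)).
by rewrite ballEmdist.
Qed.

HB.instance Definition _ := PseudoMetric_isMetric.Build R (set_type A)
  dist_ge0 dist_positivity ballE.

End induced_metric.

Section geodesics.
Context {R : realType} {X : metricType R}.
Implicit Types (c : R -> X) (x y : X).

(* A curve [[a, b] -> X] is represented by a total function [R -> X] of which
   only the values on [[a, b]] matter. *)
Definition polygonal_length (a b : R) c (s : seq R) : R :=
  let F := c \o nth b (a :: s) in
  \sum_(0 <= n < size s) mdist (F n) (F n.+1).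

Definition curve_length (a b : R) c : \bar R :=
  ereal_sup [set (polygonal_length a b c s)%:E | s in itv_partition a b].

Definition geodesic_space : Prop := forall x y, exists a b c,
  [/\ a <= b, {within `[a, b], continuous c}, c a = x, c b = y &
      curve_length a b c = (mdist x y)%:E].

Definition unit_speed (a b : R) c : Prop := forall s t,
  a <= s -> s <= t -> t <= b -> curve_length s t c = (t - s)%:E.

Definition unit_speed_minimizing_geodesic (T : R) c : Prop :=
  [/\ {within `[0, T], continuous c}, unit_speed 0 T c &
      curve_length 0 T c = (mdist (c 0) (c T))%:E].

(* Geodesics live on nondegenerate intervals: allowing [T = 0] in [LEG] would
   only rule out the one-point space, and allowing [L1 = 0] or [L2 = 0] in
   [LRB] would add nothing when [1 <= K]. *)
Definition LEG (eps : R) x : Prop := forall (T : R) c,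
  0 < T -> unit_speed_minimizing_geodesic T c ->
  (forall t, 0 <= t <= T -> ball x eps (c t)) ->
  exists c', unit_speed_minimizing_geodesic (T + eps) c' /\
             (forall t, 0 <= t <= T -> c' t = c t).

Definition LRB (H K : R) x : Prop := forall (L1 L2 : R) c1 c2,
  0 < L1 -> 0 < L2 ->
  unit_speed_minimizing_geodesic L1 c1 ->
  unit_speed_minimizing_geodesic L2 c2 ->
  (forall t, 0 <= t <= L1 -> ball x H (c1 t)) ->
  (forall t, 0 <= t <= L2 -> ball x H (c2 t)) ->
  c1 0 = c2 0 ->
  forall t, 0 <= t <= 1 ->
    mdist (c1 (t * L1)) (c2 (t * L2)) <= K * t * mdist (c1 L1) (c2 L2).

End geodesics.

Arguments geodesic_space {R} X.

(* The library's norm on ['rV[R]_n] is the sup norm. *)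
Definition euclidean_dist {R : realType} {n : nat} (u v : 'rV[R]_n) : R :=
  Num.sqrt (\sum_(i < n) (u ord0 i - v ord0 i) ^+ 2).

Definition bilipschitz_embedding {R : realType} {M : metricType R} {n : nat}
    (f : M -> 'rV[R]_n) : Prop :=
  exists2 L : R, 0 < L & forall u v : M,
    L^-1 * mdist u v <= euclidean_dist (f u) (f v) <= L * mdist u v.

Definition doubling {R : realType} (M : metricType R) : Prop :=
  exists lambda : nat, forall (rho : R) (p : M), 0 < rho ->
    exists2 s : seq M, (size s <= lambda)%N &
      ball p rho `<=` \bigcup_(q in [set` s]) ball q (rho / 2).

(* Main.v *)
(* Write f(u) = (d(u, p_i))_i for a finite net (p_i) of B_{4r}(x), which exists
   because balls are totally bounded (Hopf-Rinow). Given u <> v in B_r(x), LEG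
   extends the geodesic from u through v to a point q with d(u, q) = 3r, and
   some p_i is close to q. By LRB, at time d(u, v) / 3r the geodesic from u to
   p_i passes so close to v that d(u, p_i) - d(v, p_i) >= d(u, v) / 2; hence f
   is bi-Lipschitz. The doubling condition is then inherited from Euclidean
   space. *)

Require Import Defs.
From mathcomp Require Import all_boot all_order all_algebra.
From mathcomp Require Import all_classical all_reals all_analysis.
From mathcomp Require Import finmap ring lra.

Import Order.TTheory GRing.Theory Num.Theory.
Import numFieldNormedType.Exports.

Local Open Scope classical_set_scope.
Local Open Scope ring_scope.

(** * Unit speed minimizing geodesics as isometric curves *)

Section geodesics.
Context {R : realType} {X : metricType R}.
Implicit Types (a b s t T : R) (c : R -> X) (x y : X).

Lemma in_ballP x (e : R) y : ball x e y <-> mdist x y < e.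
Proof. by rewrite ballEmdist. Qed.

Lemma continuous_mdist x : continuous (mdist x : X -> R).
Proof.
move=> y; apply/cvgrPdist_lt => e e0.
near=> z.
have : ball y e z by near: z; exact: nbhsx_ballx.
rewrite ballEmdist/=; apply: le_lt_trans; rewrite ler_norml.
have := metric_triangle x y z; have := metric_triangle x z y.
rewrite (metric_sym z y); lra.
Unshelve. all: by end_near. Qed.

Lemma polygonal_length_cons a b c t p :
  polygonal_length a b c (t :: p) =
  mdist (c a) (c t) + polygonal_length t b c p.
Proof. by rewrite /polygonal_length /= big_nat_recl. Qed.

Lemma polygonal_length_nil a b c : polygonal_length a b c [::] = 0.
Proof. by rewrite /polygonal_length big_geq. Qed.

(** Partitions are strictly increasing, so a repeated point [a = t] is skipped; its edge has length
    zero. *)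
Lemma itv_partition_prepend a t b c p : a <= t -> itv_partition t b p ->
  exists2 q, itv_partition a b q &
    polygonal_length a b c q = mdist (c a) (c t) + polygonal_length t b c p.
Proof.
rewrite le_eqVlt => /predU1P[->|at_ [pp pl]].
  by exists p => //; rewrite mdistxx add0r.
by exists (t :: p); [split => //=; rewrite at_|exact: polygonal_length_cons].
Qed.

Lemma polygonal_le_curve_length a b c l p : curve_length a b c = l%:E ->
  itv_partition a b p -> polygonal_length a b c p <= l.
Proof.
by move=> cl abp; rewrite -lee_fin -cl; apply: ereal_sup_ubound; exists p.
Qed.

Lemma mdist3_le_curve_length a s t b c l : a <= s -> s <= t -> t <= b ->
  curve_length a b c = l%:E ->
  mdist (c a) (c s) + mdist (c s) (c t) + mdist (c t) (c b) <= l.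
Proof.
move=> as_ st tb cl.
have bb : itv_partition b b [::] by split => /=.
have [p tp pE] := itv_partition_prepend _ _ _ c _ tb bb.
have [q sq qE] := itv_partition_prepend _ _ _ c _ st tp.
have [w aw wE] := itv_partition_prepend _ _ _ c _ as_ sq.
rewrite -addrA -[X in _ + (_ + X)]addr0 -(polygonal_length_nil b b c).
rewrite -pE -qE -wE; exact: polygonal_le_curve_length.
Qed.

Lemma mdist_le_curve_length a b c l : a <= b -> curve_length a b c = l%:E ->
  mdist (c a) (c b) <= l.
Proof.
move=> ab /(mdist3_le_curve_length _ _ _ _ _ _ ab (lexx b) (lexx b)).
by rewrite !mdistxx !addr0.
Qed.

Definition isometric_on T c : Prop := forall s t,
  0 <= s -> s <= t -> t <= T -> mdist (c s) (c t) = t - s.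

Lemma isometric_onW T T' c : T' <= T -> isometric_on T c -> isometric_on T' c.
Proof. by move=> TT iso s t s0 st tT'; apply: iso => //; lra. Qed.

(** The edges of every inscribed polygon telescope to [t - s], so the supremum is over a single
    value. *)
Lemma isometric_on_unit_speed T c : isometric_on T c -> unit_speed 0 T c.
Proof.
move=> iso s t s0 st tT.
have polyE p : forall s, 0 <= s -> itv_partition s t p ->
    polygonal_length s t c p = t - s.
  elim: p => [|u p IH] {}s {}s0 {st}.
    by move=> /itv_partition_nil ->; rewrite polygonal_length_nil subrr.
  move=> stp; have [/= /andP[su _] _] := stp.
  have utp := itv_partition_cons stp.
  have ut := itv_partition_le utp.
  by rewrite polygonal_length_cons IH//; [rewrite iso//; lra|lra].
rewrite /curve_length -[RHS]ereal_sup1; congr ereal_sup.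
apply/seteqP; split => [_ [p stp <-]|_ ->]; first by rewrite polyE.
have tt : itv_partition t t [::] by split => /=.
have [p stp _] := itv_partition_prepend _ _ _ c _ st tt.
by exists p => //; rewrite polyE.
Qed.

(** Forward direction: the three subarcs have lengths [s], [t - s] and [T - t], which bound the
    distances between their ends and add up to the distance from [c 0] to [c T]; the triangle
    inequality leaves no slack. *)
Lemma geodesicP T c : 0 <= T ->
  unit_speed_minimizing_geodesic T c <-> isometric_on T c.
Proof.
move=> T0; split=> [[_ us len] s t s0 st tT|iso].
  have len0 : mdist (c 0) (c T) = T.
    by apply: EFin_inj; rewrite -len us// subr0.
  have d1 := mdist_le_curve_length _ _ _ _ s0 (us 0 s (lexx _) s0 (le_trans st tT)).
  have d2 := mdist_le_curve_length _ _ _ _ st (us s t s0 st tT).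
  have d3 := mdist_le_curve_length _ _ _ _ tT (us t T (le_trans s0 st) tT (lexx _)).
  have := metric_triangle (c 0) (c s) (c T).
  have := metric_triangle (c s) (c t) (c T).
  lra.
have us := isometric_on_unit_speed _ _ iso.
split => //; last by rewrite us// iso.
apply/subspace_continuousP => s /=; rewrite in_itv/= => /andP[s0 sT].
apply/cvg_ballP => e e0; rewrite near_withinE; near=> t.
rewrite /= in_itv/= => /andP[t0 tT]; rewrite ballEmdist/=.
suff -> : mdist (c s) (c t) = `|s - t| by near: t; exact: cvgr_dist_lt.
have [st|/ltW ts] := leP s t.
  by rewrite iso// distrC ger0_norm// subr_ge0.
by rewrite metric_sym iso// ger0_norm// subr_ge0.
Unshelve. all: by end_near. Qed.

(* A curve of length [d(x, y)] need not have unit speed; it is reparametrized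
   by the distance to [x], which is surjective by the intermediate value
   theorem. *)
Lemma geodesic_space_isometric x y : geodesic_space X ->
  exists c, [/\ isometric_on (mdist x y) c, c 0 = x & c (mdist x y) = y].
Proof.
move=> /(_ x y)[a [b [c [ab cc ca cb cl]]]].
have d3 s t : a <= s -> s <= t -> t <= b ->
    mdist x (c s) + mdist (c s) (c t) + mdist (c t) y <= mdist x y.
  by move=> *; rewrite -{1}ca -[in X in _ + X]cb; exact: mdist3_le_curve_length cl.
have gc : {within `[a, b], continuous (mdist x \o c)}.
  apply: within_continuous_comp => // z _; exact: continuous_mdist.
have /choice[tau tauP] : forall s, exists t, 0 <= s <= mdist x y ->
    [/\ a <= t, t <= b & mdist x (c t) = s].
  move=> s; have [sD|sD] := boolP (0 <= s <= mdist x y); last by exists a.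
  have [|t] := @IVT _ _ a b s ab gc.
    rewrite /= ca cb mdistxx min_l ?mdist_ge0// max_r ?mdist_ge0//.
  by rewrite in_itv/= => /andP[at_ tb] <-; exists t.
exists (c \o tau); split => /=.
- move=> s t s0 st tD.
  have [|a1 b1 e1] := tauP s; first by rewrite s0 (le_trans st).
  have [|a2 b2 e2] := tauP t; first by rewrite (le_trans s0 st).
  have := metric_triangle x (c (tau s)) (c (tau t)).
  have := metric_triangle x (c (tau t)) y.
  have := metric_triangle x (c (tau s)) y.
  have := mdist_ge0 (c (tau s)) (c (tau t)).
  (* [tau] is chosen without monotonicity. In the reversed order, [d3] bounds the distance by
     [s - t <= 0], so both it and [t - s] vanish. *)
  have [le12|/ltW le21] := leP (tau s) (tau t).
    by have := d3 _ _ a1 le12 b2; lra.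
  have := d3 _ _ a2 le21 b1; rewrite (metric_sym (c (tau t)) (c (tau s))).
  lra.
- have [|a1 b1 e1] := tauP 0; first by rewrite lexx mdist_ge0.
  exact/esym/mdist_positivity.
- have [|a1 b1 e1] := tauP (mdist x y); first by rewrite lexx mdist_ge0.
  apply: mdist_positivity.
  have := d3 _ _ a1 (lexx _) b1; have := mdist_ge0 (c (tau (mdist x y))) y.
  rewrite mdistxx; lra.
Qed.

Lemma geodesic_space_point x y t : geodesic_space X -> 0 <= t <= mdist x y ->
  exists2 z, mdist x z = t & mdist z y = mdist x y - t.
Proof.
move=> gX /andP[t0 tD]; have [c [iso c0 cD]] := geodesic_space_isometric x y gX.
exists (c t); first by rewrite -{1}c0 iso// subr0.
by rewrite -[in LHS]cD iso.
Qed.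

End geodesics.

(** * Euclidean distance, and doubling from a bi-Lipschitz embedding *)

Section euclidean.
Context {R : realType} {n : nat}.
Implicit Types u v : 'rV[R]_n.

Lemma coord_le_euclidean_dist u v i :
  `|u ord0 i - v ord0 i| <= euclidean_dist u v.
Proof.
rewrite -sqrtr_sqr ler_wsqrtr// (bigD1 i)//= lerDl.
by apply: sumr_ge0 => j _; exact: sqr_ge0.
Qed.

Lemma euclidean_dist_le_sum u v :
  euclidean_dist u v <= \sum_(i < n) `|u ord0 i - v ord0 i|.
Proof.
have S0 : 0 <= \sum_(i < n) `|u ord0 i - v ord0 i| by apply: sumr_ge0.
rewrite -(ger0_norm S0) -sqrtr_sqr ler_wsqrtr// expr2 mulr_suml.
apply: ler_sum => i _; rewrite -real_normK ?num_real// expr2 ler_wpM2l//.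
by rewrite (bigD1 i)//= lerDl sumr_ge0.
Qed.

End euclidean.

(* A ball is sorted according to the cell of a cubical grid, of mesh
   proportional to its radius, which contains the image of a point. The number
   of cells met by the image does not depend on the radius. *)
Lemma bilipschitz_embedding_doubling (R : realType) (M : metricType R) (n : nat)
    (f : M -> 'rV[R]_n) : bilipschitz_embedding f -> doubling M.
Proof.
move=> [L L0 fL].
(* For the mesh [m = rho / C] this gives [L * (n * m) < rho / 2]; [n + 1] keeps [C] positive in
   dimension 0 and the inequality strict. *)
pose C := 2 * L * (n%:R + 1).
have C0 : 0 < C by rewrite !mulr_gt0// ltr_wpDl.
(* On the ball each coordinate ranges over an interval of length [2 * L * rho], that is [2 * L * C]
   meshes. *)
pose N := (Num.truncn (2 * L * C)).+1.
exists #|{ffun 'I_n -> 'I_N}| => rho p rho0.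
pose m := rho / C.
have m0 : 0 < m by rewrite divr_gt0.
pose cell (u : M) : {ffun 'I_n -> 'I_N} :=
  [ffun i => inord (Num.truncn ((f u ord0 i - f p ord0 i + L * rho) / m))].
(* Centres must be points of [M]: each cell met by the ball gets a representative in the ball, any
   other cell the default [p]. *)
have /choice[pick pickP] : forall k : {ffun 'I_n -> 'I_N}, exists v,
    (exists2 u, ball p rho u & cell u = k) -> ball p rho v /\ cell v = k.
  move=> k; have [[u pu uk]|no] := pselect (exists2 u, ball p rho u & cell u = k).
    by exists u.
  by exists p.
exists [seq pick k | k <- enum {ffun 'I_n -> 'I_N}].
  by rewrite size_map -cardE.
move=> u pu; have [|pv cellv] := pickP (cell u); first by exists u.
set v := pick (cell u) in pv cellv.
exists v; first by apply/mapP; exists (cell u) => //; rewrite mem_enum.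
have bnd w i : ball p rho w ->
    0 <= (f w ord0 i - f p ord0 i + L * rho) / m < N%:R.
  rewrite ballEmdist/= => pw.
  have := coord_le_euclidean_dist (f w) (f p) i.
  have /andP[_ +] := fL w p; rewrite metric_sym => h1 h2.
  have h3 : L * mdist p w < L * rho by rewrite ltr_pM2l.
  have : `|f w ord0 i - f p ord0 i| < L * rho.
    by rewrite (le_lt_trans h2)// (le_lt_trans h1).
  rewrite ltr_norml => /andP[h4 h5].
  apply/andP; split; first by rewrite divr_ge0 ?(ltW m0)//; lra.
  apply: lt_trans (Num.Theory.truncnS_gt (2 * L * C)).
  have mE : 2 * L * C * m = 2 * (L * rho) by rewrite /m; field; rewrite gt_eqF.
  rewrite ltr_pdivrMr// mE; lra.
have close i : `|f v ord0 i - f u ord0 i| <= m.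
  have /(congr1 (fun k : {ffun 'I_n -> 'I_N} => nat_of_ord (k i))) := cellv.
  have /andP[v0 vN] := bnd v i pv; have /andP[u0 uN] := bnd u i pu.
  (* [inord] is faithful below [N], so equal cells mean equal truncations. *)
  rewrite !ffunE !inordK; [|by rewrite Num.Theory.truncn_lt_nat ..].
  move: v0 vN u0 uN.
  set a := (_ / m); set b := (_ / m) => a0 _ b0 _ ab.
  have := Num.Theory.truncn_itv a0; have := Num.Theory.truncn_itv b0.
  rewrite ab => /andP[b1 b2] /andP[a1 a2].
  have -> : f v ord0 i - f u ord0 i = (a - b) * m.
    rewrite mulrBl /a /b !divfK ?gt_eqF//; lra.
  rewrite normrM (gtr0_norm m0) ler_piMl ?ltW// ltr_norml.
  rewrite -natr1 in a2 b2; lra.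
have /andP[low _] := fL v u.
have upp : euclidean_dist (f v) (f u) <= n%:R * m.
  apply: (le_trans (euclidean_dist_le_sum _ _)).
  apply: (le_trans (ler_sum _ (fun i _ => close i))).
  by rewrite sumr_const card_ord mulr_natl.
rewrite ballEmdist/=.
have : mdist v u <= L * (n%:R * m).
  by rewrite -ler_pdivrMl// (le_trans low).
move=> /le_lt_trans; apply.
have -> : rho / 2 = L * ((n%:R + 1) * m).
  rewrite /m /C; field; rewrite gt_eqF//= gt_eqF// ltr_wpDl//.
by rewrite ltr_pM2l// ltr_pM2r// ltrDl.
Qed.

(** * Total boundedness of balls *)

Section totally_bounded.
Context {R : realType} {X : completeMetricType R}.
Implicit Types (A B : set X) (x y : X) (s : seq X).

(** Centres may lie outside [A], so a net also serves every subset. *)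
Definition totally_bounded A : Prop := forall d : R, 0 < d ->
  exists s, A `<=` \bigcup_(q in [set` s]) ball q d.

Lemma totally_bounded_sub A B :
  A `<=` B -> totally_bounded B -> totally_bounded A.
Proof. by move=> AB tB d /tB[s Bs]; exists s; exact: subset_trans Bs. Qed.

Lemma totally_bounded_bigcup (T : eqType) (l : seq T) (F : T -> set X) :
  (forall i, totally_bounded (F i)) ->
  totally_bounded (\bigcup_(i in [set` l]) F i).
Proof.
move=> tF d d0; have /choice[s sP] := fun i => tF i d d0.
exists (flatten [seq s i | i <- l]) => y [i /= il /sP[q qs qy]].
by exists q => //=; apply/flatten_mapP; exists i.
Qed.

Lemma compact_totally_bounded A : compact A -> totally_bounded A.
Proof.
rewrite compact_cover => Ac d d0.
have [| |D' _ AD'] := Ac X setT (fun q => (ball q d)°).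
- by move=> q _; exact: open_interior.
- move=> q _; exists q => //; apply: nbhs_singleton.
  by apply: nbhs_interior; exact: nbhsx_ballx.
- by exists D' => y /AD'[q qD' /interior_subset]; exists q.
Qed.

(** Pigeonhole principle for ultrafilters: each [F i] or its complement belongs to [G]. *)
Lemma ultra_bigcup (T : eqType) (l : seq T) (F : T -> set X) (G : set_system X) :
  UltraFilter G -> G (\bigcup_(i in [set` l]) F i) -> exists i, G (F i).
Proof.
move=> UG; elim: l => [|i l IH].
  rewrite set_nil bigcup_set0 => G0.
  by case: (@filter_not_empty X G _ G0).
move=> GU; have [GF|GF] := in_ultra_setVsetC (F i) UG; first by exists i.
apply: IH; apply: filterS (filterI GU GF) => y [[j /= + Fy] nFy].
by rewrite inE => /predU1P[ji|jl]; [case: nFy; rewrite -ji|exists j].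
Qed.

(** An ultrafilter on the closure contains a ball of every radius, hence is Cauchy and converges by
    completeness. *)
Lemma totally_bounded_compact A : totally_bounded A -> compact (closure A).
Proof.
move=> tA; rewrite compact_ultra => G UG GA.
have cG : cauchy G.
  apply: cauchy_exP => d d0.
  have [s As] := tA (d / 2) (divr_gt0 d0 (ltr0Sn _ 1)).
  apply: (ultra_bigcup _ s (fun q => ball q d)); apply: filterS GA => y cy.
  have [z [/As[q qs qz] yz]] := cy _ (nbhsx_ballx y _ (divr_gt0 d0 (ltr0Sn _ 1))).
  by exists q => //; exact: ball_split qz (ball_sym yz).
have /cvg_ex[p Gp] : cvg G by exact: cauchy_cvg.
exists p; split => //.
apply: (closed_cvg _ _ _ _ Gp); [exact: closed_closure|exact: GA].
Qed.

(* Hopf-Rinow: at a finite supremum of the radii of totally bounded balls, the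
   closed ball would be compact, hence local compactness would give uniform
   room to enlarge it. *)
Lemma ball_totally_bounded x (t : R) : locally_compact [set: X] ->
  geodesic_space X -> totally_bounded (ball x t).
Proof.
move=> lX gX.
have loc y : exists2 e : R, 0 < e & totally_bounded (ball y e).
  have [U + [Uc _]] := lX y I.
  rewrite withinET => /nbhs_ballP[e /= e0 yU]; exists e => //.
  by apply: totally_bounded_sub yU _; exact: compact_totally_bounded.
have mono (a b : R) : a <= b -> totally_bounded (ball x b) ->
    totally_bounded (ball x a).
  by move=> ab; apply: totally_bounded_sub; exact: le_ball.
apply: contrapT => nt.
pose S := [set a : R | totally_bounded (ball x a)].
have St a : S a -> a <= t.
  by move=> Sa; rewrite leNgt; apply/negP => /ltW ta; exact/nt/(mono _ _ ta).
have [e0 e0_gt0 Se0] := loc x.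
have supS : has_sup S by split; [exists e0|exists t].
set a := sup S.
have a0 : 0 < a by apply: lt_le_trans e0_gt0 _; exact: sup_upper_bound.
(* The supremum is attained: points of [ball x a] are pulled back by at most [d / 2] along geodesics
   to [x], into a smaller ball that has a net. *)
have Sa : totally_bounded (ball x a).
  move=> d d0; have d20 : 0 < d / 2 by rewrite divr_gt0.
  (* The minimum with [a] forces [b] to be positive, which is needed when [h] is truncated to 0. *)
  have [|b Sb ab] := @sup_adherent _ S (Num.min (d / 2) a) _ supS.
    by rewrite lt_min d20.
  have [ab1 ab2] : a - d / 2 < b /\ 0 < b.
    have m1 : Num.min (d / 2) a <= d / 2 by rewrite ge_min lexx.
    have m2 : Num.min (d / 2) a <= a by rewrite ge_min lexx orbT.
    by rewrite -/a in ab; split; lra.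
  have [s bs] := Sb _ d20.
  exists s => y; rewrite ballEmdist/= => xy.
  pose h := Num.max 0 (mdist x y - d / 2).
  have h_ge0 : 0 <= h by rewrite le_max lexx.
  have h_ge : mdist x y - d / 2 <= h by rewrite le_max lexx orbT.
  have hle : h <= mdist x y.
    by rewrite ge_max mdist_ge0/= lerBlDr lerDl ltW.
  have hb : h < b.
    by rewrite gt_max ab2/=; lra.
  have [|z xz zy] := @geodesic_space_point _ _ x y h gX; first exact/andP.
  have [|q qs qz] := bs z; first by rewrite ballEmdist/= xz.
  exists q => //; move: qz; rewrite !ballEmdist/=.
  have := metric_triangle q z y; lra.
have /compact_near_coveringP Kc := totally_bounded_compact _ Sa.
have nearK : \forall e \near (0 : R)^'+,
    closure (ball x a) `<=` (fun y => totally_bounded (ball y e)).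
  apply: Kc => y _; have [e e_gt0 ye] := loc y.
  have e2 : 0 < e / 2 by rewrite divr_gt0.
  exists (ball y (e / 2), [set d | d < e / 2]) => /=.
    by split; [exact: nbhsx_ballx|exact: nbhs_right_lt].
  move=> [z d] /= [yz de]; apply: totally_bounded_sub ye => w zw.
  apply: ball_split yz _; exact: le_ball (ltW de) _ zw.
have [e [e_gt0 eK]] : exists e : R, 0 < e /\
    closure (ball x a) `<=` (fun y => totally_bounded (ball y e)).
  near (0 : R)^'+ => e; exists e; split; near: e => //; exact: nbhs_right_gt.
(* Two points of [ball q h] are less than [2 * h] apart, and enlarging costs another [h]: in total
   [e]. *)
pose h := e / 3; have h_gt0 : 0 < h by rewrite divr_gt0.
suff /(sup_upper_bound supS) : S (a + h) by rewrite -/a gerDl leNgt h_gt0.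
have [s as_] := Sa _ h_gt0.
pose F q := [set z | exists2 w, (ball x a `&` ball q h) w & mdist w z <= h].
apply: (@totally_bounded_sub _ (\bigcup_(q in [set` s]) F q)); last first.
  apply: totally_bounded_bigcup => q.
  (* [eK] requires a centre in [ball x a]; if there is none, [F q] is empty. *)
  have [[y [xy qy]]|no] := pselect (exists y, (ball x a `&` ball q h) y).
    apply: totally_bounded_sub (eK y (subset_closure xy)) => z [w [_ qw] wz].
    move: qy qw; rewrite !ballEmdist/=.
    have := metric_triangle y w z; have := metric_triangle y q w.
    rewrite (metric_sym y q) /h in wz *; lra.
  by move=> d d0; exists [::] => z [w xw _]; case: no; exists w.
move=> z; rewrite ballEmdist/= => xz.
pose g := Num.max 0 (mdist x z - h).
have g_ge0 : 0 <= g by rewrite le_max lexx.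
have g_ge : mdist x z - h <= g by rewrite le_max lexx orbT.
have gle : g <= mdist x z by rewrite ge_max mdist_ge0/= lerBlDr lerDl ltW.
have ga : g < a by rewrite gt_max a0/=; lra.
have [|w xw wz] := @geodesic_space_point _ _ x z g gX; first exact/andP.
have xaw : ball x a w by rewrite ballEmdist/= xw.
have [q qs qw] := as_ _ xaw.
by exists q => //; exists w => //; rewrite wz; lra.
Unshelve. all: by end_near. Qed.
End totally_bounded.

(** * Distance coordinates and the embedding *)

(* [q] lies beyond [v] on an extension of the geodesic from [u] to [v], and
   [LRB] at [u] compares the geodesics from [u] to [q] and to [p]. *)
Lemma LEG_LRB_strainer (R : realType) (X : metricType R) (x : X)
    (eps H K r d : R) (u v : X) : geodesic_space X ->
  LEG eps x -> LRB H K x -> 1 <= K -> 12 * r < eps -> 12 * r < H ->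
  0 < d -> (K + 1) * d = 3 * r / 2 ->
  ball x r u -> ball x r v -> u != v ->
  exists2 q, ball x (4 * r) q &
    forall p, mdist q p <= d -> mdist u v / 2 <= mdist u p - mdist v p.
Proof.
move=> gX leg lrb K1 re rH d0 dE; rewrite !ballEmdist/= => xu xv uv.
have r0 : 0 < r by rewrite (le_lt_trans (mdist_ge0 x u)).
have dr : d <= 3 * r / 4 by nra.
set l := mdist u v.
have l0 : 0 < l by rewrite mdist_gt0.
have l2r : l < 2 * r.
  by have := metric_triangle u x v; rewrite -/l (metric_sym u x); lra.
have [c [ciso c0 cl]] := geodesic_space_isometric u v gX.
(* The geodesic from [u] to [v] stays within [3 * r < eps] of [x], and its extension has length at
   least [eps], which exceeds [3 * r]. *)
have [|t /andP[t0 tl]|c' [/geodesicP c'geo c'E]] := leg l c l0.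
- by apply/geodesicP => //; exact: ltW.
- apply/in_ballP.
  have := ciso 0 t (lexx _) t0 tl; rewrite c0 subr0.
  have := metric_triangle x u (c t); lra.
have {c'geo} c'iso : isometric_on (l + eps) c' by apply: c'geo; lra.
have c'0 : c' 0 = u by rewrite c'E// lexx ltW.
have c'l : c' l = v by rewrite c'E ?cl// lexx ltW.
have uq : mdist u (c' (3 * r)) = 3 * r.
  by rewrite -{1}c'0 c'iso ?subr0//; lra.
exists (c' (3 * r)).
  by have := metric_triangle x u (c' (3 * r)); lra.
move=> p qp; set L := mdist u p.
have L_ge : 3 * r - d <= L.
  have := metric_triangle u p (c' (3 * r)).
  by rewrite -/L (metric_sym p); lra.
have L_le : L <= 3 * r + d.
  by have := metric_triangle u (c' (3 * r)) p; rewrite -/L; lra.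
have [g [giso g0 gL]] := geodesic_space_isometric u p gX.
(* The proportional time at which the extended geodesic to [q] passes through [v]. *)
pose t := l / (3 * r).
have tE : t * (3 * r) = l by rewrite /t divfK// gt_eqF//; lra.
have t0 : 0 < t by rewrite divr_gt0//; lra.
have t1 : t <= 1 by rewrite ler_pdivrMr; lra.
have tL : t * L <= L by rewrite ler_piMl//; lra.
have tL0 : 0 <= t * L by rewrite mulr_ge0//; lra.
have := lrb (3 * r) L c' g.
have -> : c' 0 = g 0 by rewrite c'0.
rewrite (_ : mdist (c' (3 * r)) (g L) = mdist (c' (3 * r)) p); last by rewrite gL.
move=> /(_ _ _ _ _ _ _ erefl t) lrbt.
have {lrbt} : mdist v (g (t * L)) <= K * t * mdist (c' (3 * r)) p.
  rewrite -c'l -tE; apply: lrbt => //.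
  - by lra.
  - by lra.
  - by apply/geodesicP; [lra|apply: isometric_onW c'iso; lra].
  - by apply/geodesicP => //; lra.
  (* Both geodesics start within [r] of [x] and have length at most [3 * r + d], so they stay within
     [5 * r < H]. *)
  - move=> s /andP[s0 sr]; apply/in_ballP.

    have := metric_triangle x u (c' s).
    rewrite -{2}c'0 c'iso ?subr0//; lra.
  - move=> s /andP[s0 sr]; apply/in_ballP.

    have := metric_triangle x u (g s).
    rewrite -{2}g0 giso ?subr0//; lra.
  - by rewrite ltW.
have gp : mdist (g (t * L)) p = L - t * L by rewrite -{1}gL giso.
have := metric_triangle v (g (t * L)) p; rewrite gp => h1 h2.
have h3 : K * t * mdist (c' (3 * r)) p <= K * t * d.
  by rewrite ler_wpM2l// mulr_ge0//; lra.
(* The gain [L - d(v, p)] is at least [t * (L - K * d)], and the choice of [d] makes the left side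
   here equal to [t * (3 * r) / 2 = l / 2]. *)
have h4 : t * (3 * r - d - K * d) <= t * (L - K * d).
  by rewrite ler_wpM2l//; lra.
nra.
Qed.

(** Each distance function is 1-Lipschitz, which gives the upper bound after summation; one
    separating coordinate gives the lower bound. *)
Lemma distances_to_net_bilipschitz (R : realType) (X : metricType R) (A : set X)
    (s : seq X) :
  (forall u v, A u -> A v -> u != v ->
     exists2 p, p \in s & mdist u v / 2 <= mdist u p - mdist v p) ->
  bilipschitz_embedding (fun u : set_type A =>
    \row_(i < size s) mdist (set_val u) (tnth (in_tuple s) i)).
Proof.
move=> As; set f := (fun u : set_type A => _).
have n0 : 0 <= (size s)%:R :> R by [].
(* The added 2 makes the inverse constant at most 1/2. *)
exists ((size s)%:R + 2); first by lra.
move=> u v; have duv : mdist u v = mdist (set_val u) (set_val v) by [].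
have fE i : f u ord0 i - f v ord0 i = mdist (set_val u) (tnth (in_tuple s) i) -
    mdist (set_val v) (tnth (in_tuple s) i) by rewrite !mxE.
have d0 := mdist_ge0 u v.
apply/andP; split.
  have [->|uv] := eqVneq u v.
    by rewrite mdistxx mulr0 sqrtr_ge0.
  have [|||p ps up] := As (set_val u) (set_val v).
  - exact/set_mem/valP.
  - exact/set_mem/valP.
  - by apply: contra uv => /eqP/val_inj ->.
  have [i pi] : exists i, p = tnth (in_tuple s) i by apply/tnthP.
  apply: le_trans (coord_le_euclidean_dist _ _ i).
  apply: le_trans (ler_norm _); rewrite fE -pi.
  apply: le_trans up; rewrite -duv mulrC ler_wpM2l// lef_pV2 ?posrE//; lra.
apply: (le_trans (euclidean_dist_le_sum _ _)).
apply: (@le_trans _ _ (\sum_(i < size s) mdist u v)).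
  apply: ler_sum => i _; rewrite fE duv ler_norml.
  set p := tnth _ _.
  have := metric_triangle (set_val u) (set_val v) p.
  have := metric_triangle (set_val v) (set_val u) p.
  rewrite (metric_sym (set_val v) (set_val u)); lra.
by rewrite sumr_const card_ord -[leLHS]mulr_natl ler_wpM2r//; lra.
Qed.

Theorem theorem4 (R : realType) (X : completeMetricType R)
  (X_locally_compact : locally_compact [set: X])
  (X_geodesic : geodesic_space X)
  (x : X) (eps H K : R) (eps_gt0 : 0 < eps) (H_gt0 : 0 < H) (K_ge1 : 1 <= K)
  (x_LEG : LEG eps x) (x_LRB : LRB H K x)
  (r : R) (r_gt0 : 0 < r) (r_lt : r < Num.min eps H / (12 * K)) :
  (exists (n : nat) (f : set_type (ball x r) -> 'rV[R]_n),
     bilipschitz_embedding f) /\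
  doubling (set_type (ball x r)).
Proof.
have [re rH] : 12 * r < eps /\ 12 * r < H.
  have K12 : 0 < 12 * K by lra.
  move: r_lt; rewrite ltr_pdivlMr// lt_min => /andP[h1 h2].
  have : 12 * r <= r * (12 * K) by nra.
  by split; lra.
(* The net scale at which the total loss [(K + 1) * d] is half of [3 * r]. *)
pose d := 3 * r / 2 / (K + 1).
have dE : (K + 1) * d = 3 * r / 2 by rewrite mulrC divfK// gt_eqF//; lra.
have d0 : 0 < d by rewrite !divr_gt0//; lra.
have [s xs] := ball_totally_bounded x (4 * r) X_locally_compact X_geodesic d d0.
have emb : bilipschitz_embedding (fun u : set_type (ball x r) =>
    \row_(i < size s) mdist (set_val u) (tnth (in_tuple s) i)).
  apply: distances_to_net_bilipschitz => u v xu xv uv.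
  have [q xq qP] := LEG_LRB_strainer _ _ x eps H K r d u v X_geodesic
    x_LEG x_LRB K_ge1 re rH d0 dE xu xv uv.
  have [p ps /in_ballP pq] := xs _ xq.
  by exists p => //; apply: qP; rewrite metric_sym ltW.
split; last exact: bilipschitz_embedding_doubling emb.
by exists (size s); eexists; exact: emb.
Qed.
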